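(* For every cardinal $\lambda\geq\omega_1$, $\mathsf{MA}^{1.5}_\lambda$ implies $(\cdot)^\tau_\lambda$ for every ordinal $\tau<\omega_1$.
   Context: $\mathrm{TC}(x)$ is the transitive closure of $x$. For a set $N$ such that $N\cap\omega_1$ is an ordinal, $\delta_N:=N\cap\omega_1$. Given a poset $\mathbb P$ and a submodel $N$ of $\langle H(\theta),\in\rangle$ with $\mathbb P\in N$ and $\theta\geq|\mathrm{TC}(\mathbb P)|^+$, a condition $p\in\mathbb P$ is $(N,\mathbb P)$-generic if for every extension $p'$ of $p$ and every dense subset $D$ of $\mathbb P$ belonging to $N$ there is some condition in $D\cap N$ compatible with $p'$. $\aleph_{1.5}$-chain condition: a poset $\mathbb P$ has the $\aleph_{1.5}$-chain condition (is $\aleph_{1.5}$-c.c.) if and only if for every regular cardinal $\lambda\geq|\mathrm{TC}(\mathbb P)|^+$ there is a club $D\subseteq[H(\lambda)]^{\aleph_0}$ such that for every finite $\{N_i : i<n\}\subseteq D$ and every $p\in\mathbb P$, if $p\in N_j$ for some $j$ such that $\delta_{N_j}=\min\{\delta_{N_i} : i<n\}$, then there is some condition extending $p$ which is $(N_i,\mathbb P)$-generic for all $i<n$. (All members of $D$ may be taken to be countable elementary substructures of $\langle H(\lambda),\in\rangle$ containing $\mathbb P$.) $\mathsf{MA}^{1.5}_\lambda$: for every $\aleph_{1.5}$-c.c. poset $\mathbb P$ and every collection $\mathcal D$ of size $\lambda$ consisting of dense subsets of $\mathbb P$ there is a filter $G\subseteq\mathbb P$ such that $G\cap D\neq\emptyset$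 for all $D\in\mathcal D$. Cantor--Bendixson rank: given a set $X$ and an ordinal $\delta$, $\mathrm{rank}(X,\delta)$ is specified by: $\mathrm{rank}(X,\delta)\geq 1$ if and only if $\delta$ is a limit point of ordinals in $X$; and if $\mu>1$, $\mathrm{rank}(X,\delta)\geq\mu$ if and only if for every $\eta<\mu$, $\delta$ is a limit of ordinals $\epsilon$ with $\mathrm{rank}(X,\epsilon)\geq\eta$. Given an ordinal $\tau$, a set $X$ of ordinals is $\tau$-thin if $\mathrm{rank}(X,\delta)\leq\tau$ for all ordinals $\delta$. $(\cdot)^\tau_\lambda$ (for ordinals $\tau<\omega_1$ and $\lambda$): for every sequence $(A_i)_{i<\lambda}$, if $A_i$ is a $\tau$-thin subset of $\omega_1$ for all $i<\lambda$, then there is a club $C\subseteq\omega_1$ such that $|C\cap A_i|<\aleph_0$ for all $i<\lambda$. *)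

(* Defs.v *)
From HB Require Import structures.
From mathcomp Require Import all_boot.
From mathcomp Require Import boolp classical_sets functions cardinality.

Set Implicit Arguments.
Unset Strict Implicit.
Unset Printing Implicit Defensive.

Local Open Scope classical_set_scope.
Local Open Scope card_scope.
Local Open Scope quotient_scope.

(* The universe of sets: Aczel's well-founded trees, quotiented by their      *)
(* extensional equality, so that equality of sets is Leibniz equality. Under  *)
(* classical logic and choice, V is a model of ZFC.                           *)

Inductive tree : Type := Sup (I : Type) (f : I -> tree).

Fixpoint teq (s t : tree) : Prop :=
  let: Sup K f := s in
  let: Sup L g := t in
  (forall i, exists j, teq (f i) (g j)) /\ (forall j, exists i, teq (f i) (g j)).

Lemma teq_refl t : teq t t.
Proof. by elim: t => I f IH /=; split=> i; exists i. Qed.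

Lemma teq_sym s t : teq s t -> teq t s.
Proof.
elim: s t => I f IH [J g] /= [fg gf]; split=> [j|i].
- by have [i /IH] := gf j; exists i.
- by have [j /IH] := fg i; exists j.
Qed.

Lemma teq_trans s t u : teq s t -> teq t u -> teq s u.
Proof.
elim: s t u => I f IH [J g] [K h] /= [fg gf] [gh hg]; split=> [i|k].
- by have [j fgij] := fg i; have [k ghjk] := gh j; exists k; apply: IH fgij ghjk.
- by have [j ghjk] := hg k; have [i fgij] := gf j; exists i; apply: IH fgij ghjk.
Qed.

HB.instance Definition _ := gen_eqMixin tree.
HB.instance Definition _ := gen_choiceMixin tree.

Definition teqb (s t : tree) : bool := `[< teq s t >].

Lemma teqb_equiv : equiv_class_of teqb.
Proof.
split=> [t|s t|t s u].
- exact/asboolP/teq_refl.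
- by apply/asboolP/asboolP; apply: teq_sym.
- by move=> /asboolP st /asboolP tu; apply/asboolP/(teq_trans st tu).
Qed.

Canonical teqb_rel := EquivRelPack teqb_equiv.

Definition V := {eq_quot teqb}.
HB.instance Definition _ := Choice.on V.

Definition fam (I : Type) (f : I -> V) : V := \pi_V (Sup (fun i => repr (f i))).

Definition elts (x : V) : set V :=
  let: Sup K f := repr x in [set y | exists i, y = \pi_V (f i)].
Coercion elts : V >-> set.

Notation "x ∈ y" := (elts y x) (at level 70, no associativity).

Lemma teq_pi s t : teq s t <-> \pi_V s = \pi_V t.
Proof.
split=> [st|/eqmodP/asboolP//].
by apply/eqmodP/asboolP.
Qed.

Lemma elts_pi I (f : I -> tree) : elts (\pi_V (Sup f)) = [set y | exists i, y = \pi_V (f i)].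
Proof.
rewrite /elts; have := reprK (\pi_V (Sup f)).
case: (repr _) => J g /teq_pi /= [gf fg]; apply/seteqP; split=> y /= [k ->].
- by have [i /teq_pi ->] := gf k; exists i.
- by have [j /teq_pi <-] := fg k; exists j.
Qed.

Lemma elts_fam (I : Type) (f : I -> V) : elts (fam f) = range f.
Proof.
rewrite elts_pi; apply/seteqP; split=> y /= [i].
- by move=> ->; exists i; rewrite ?reprK.
- by move=> _ <-; exists i; rewrite reprK.
Qed.

Lemma fam_elts (x : V) : exists (I : Type) (f : I -> V), x = fam f.
Proof.
elim/quotW: x => -[I f]; exists I, (fun i => \pi_V (f i)); apply/teq_pi => /=.
by split=> i; exists i; apply/teq_pi; rewrite reprK.
Qed.

Lemma elts_inj : injective elts.
Proof.
elim/quotW=> -[I f]; elim/quotW=> -[J g]; rewrite !elts_pi => /seteqP[fg gf].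
apply/teq_pi; split=> [i|j].
- by have [j /teq_pi] := fg _ (ex_intro _ i erefl); exists j.
- by have [i /esym/teq_pi] := gf _ (ex_intro _ j erefl); exists i.
Qed.

Lemma mem_ind (P : V -> Prop) :
  (forall x, (forall y, y ∈ x -> P y) -> P x) -> forall x, P x.
Proof.
move=> H; elim/quotW; elim=> I f IH; apply: H => y.
by rewrite elts_pi => -[i ->].
Qed.

(* Classes [set V] are used for sets of sets wherever no membership in        *)
(* another set is at stake; this is harmless, as separation and replacement   *)
(* hold in V for arbitrary predicates and functions.                          *)

Lemma separation (x : V) (A : set V) : exists y : V, elts y = x `&` A.
Proof.
have [I [f ->]] := fam_elts x.
exists (fam (fun i : {i | A (f i)} => f (sval i))); rewrite !elts_fam.
apply/seteqP; split=> [_ [[i Ai] _ <-]|_ [[i _ <-] Ai]] /=.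
- by split=> //; exists i.
- by exists (exist _ i Ai).
Qed.

Lemma replacement (x : V) (F : V -> V) : exists y : V, elts y = F @` x.
Proof.
have [I [f ->]] := fam_elts x; exists (fam (F \o f)).
by rewrite !elts_fam image_comp.
Qed.

Definition upair (x y : V) : V := fam (fun b : bool => if b then x else y).
Definition opair (x y : V) : V := upair (upair x x) (upair x y).

Definition zero : V := fam (fun e : False => match e with end).
Definition one : V := upair zero zero.

Lemma elts_upair x y : elts (upair x y) = [set x; y].
Proof.
rewrite elts_fam; apply/seteqP; split=> [_ [[] _ <-]|_ [->|->]] /=; [by left|by right| |].
- by exists true.
- by exists false.
Qed.

Lemma elts_zero : elts zero = set0.
Proof. by rewrite elts_fam; apply/seteqP; split=> // _ [[]]. Qed.

Lemma elts_one : elts one = [set zero].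
Proof. by rewrite elts_upair setUid. Qed.

Definition transitive_class (T : set V) : Prop := forall x, T x -> x `<=` T.

Definition ordinal (a : V) : Prop :=
  transitive_class a /\ forall b, b ∈ a -> transitive_class b.

Definition card_lt T U (A : set T) (B : set U) : Prop :=
  A #<= B /\ ~ (B #<= A).

Definition cardinal (k : V) : Prop :=
  ordinal k /\ forall a, a ∈ k -> card_lt a k.

(* |A|^+ is the set of all ordinals of cardinality at most |A|; for such      *)
(* von Neumann ordinals, <= is inclusion.                                     *)
Definition succ_card T (A : set T) : set V := [set a | ordinal a /\ a #<= A].

Definition omega1 : set V := succ_card [set: nat].

(* cf(k) = k: every cofinal subset of k has cardinality k.                    *)
Definition regular (k : V) : Prop :=
  [/\ cardinal k, infinite_set k &
      forall S : set V, S `<=` k ->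
        (forall a, a ∈ k -> exists2 b, S b & a `<=` b) -> S #= k].

Definition TC (x : V) : set V :=
  \bigcap_(T in [set T : set V | transitive_class T /\ x `<=` T]) T.

Definition Hset (k : V) : set V := [set x | card_lt (TC x) k].

Definition ctble_subsets (X : set V) : set (set V) :=
  [set a | a `<=` X /\ a #= [set: nat]].

Definition club_subsets (X : set V) (D : set (set V)) : Prop :=
  [/\ D `<=` ctble_subsets X,
      forall a, ctble_subsets X a -> exists2 N, D N & a `<=` N &
      forall N : nat -> set V, (forall n, D (N n)) ->
        (forall n, N n `<=` N n.+1) -> D (\bigcup_n N n)].

(* The poset is the set opair X R, where R consists of the opair p q with     *)
(* p <= q. The empty poset is excluded, as it has no (nonempty) filter.       *)
Record poset (X R : V) : Prop := Poset {
  poset_nonempty : X !=set0;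
  poset_rel : forall z, z ∈ R -> exists p q, [/\ p ∈ X, q ∈ X & z = opair p q];
  poset_refl : forall p, p ∈ X -> opair p p ∈ R;
  poset_antisym : forall p q, opair p q ∈ R -> opair q p ∈ R -> p = q;
  poset_trans : forall p q r, opair p q ∈ R -> opair q r ∈ R -> opair p r ∈ R }.

Definition extends (R p q : V) : Prop := opair p q ∈ R.

Definition compatible (R p q : V) : Prop :=
  exists r, extends R r p /\ extends R r q.

Definition dense (X R D : V) : Prop :=
  D `<=` X /\ forall p, p ∈ X -> exists2 d, d ∈ D & extends R d p.

Definition is_filter (X R : V) (G : set V) : Prop :=
  [/\ G `<=` X, G !=set0,
      forall p q, G p -> extends R p q -> G q &
      forall p q, G p -> G q -> exists r, [/\ G r, extends R r p & extends R r q]].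

Definition generic (N : set V) (X R p : V) : Prop :=
  forall p', extends R p' p -> forall D, N D -> dense X R D ->
    exists d, [/\ d ∈ D, N d & compatible R d p'].

Definition delta (N : set V) : set V := N `&` omega1.

(* The second condition on D is what makes delta N an ordinal and genericity  *)
(* over N meaningful. It is no restriction: the third condition passes to     *)
(* smaller clubs, and countable elementary substructures of Hset k containing *)
(* the poset satisfy the second. Ordinals delta N are compared by inclusion.  *)
Definition aleph15_cc (X R : V) : Prop :=
  forall k : V, regular k -> succ_card (TC (opair X R)) `<=` k ->
  exists D : set (set V),
    [/\ club_subsets (Hset k) D,
        forall N, D N -> N (opair X R) /\ exists2 a : V, ordinal a & elts a = delta N &
        forall (n : nat) (N : 'I_n -> set V), (forall i, D (N i)) ->
        forall p, p ∈ X ->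
          (exists2 j, N j p & forall i, delta (N j) `<=` delta (N i)) ->
          exists2 q, extends R q p & forall i, generic (N i) X R q].

Definition MA15 (l : V) : Prop :=
  forall X R : V, poset X R -> aleph15_cc X R ->
  forall DD : set V, DD #= l -> (forall D, DD D -> dense X R D) ->
  exists2 G : set V, is_filter X R G & forall D, DD D -> (G `&` D) !=set0.

(* The first conjunct excludes d = 0, which is not a limit point.             *)
Definition limit_point (A : set V) (d : V) : Prop :=
  d !=set0 /\ forall x, x ∈ d -> exists e, [/\ A e, x ∈ e & e ∈ d].

(* rank_ge A m d states rank(A, d) >= m.                                      *)
Inductive rank_ge (A : set V) : V -> V -> Prop :=
| rank_ge_zero d : rank_ge A zero d
| rank_ge_one d : limit_point A d -> rank_ge A one d
| rank_ge_gt1 m d : ordinal m -> one ∈ m ->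
    (forall n, n ∈ m -> limit_point (rank_ge A n) d) -> rank_ge A m d.

Lemma one_notin_one : ~ one ∈ one.
Proof.
rewrite elts_one => /(congr1 elts); rewrite elts_one elts_zero => /seteqP[+ _].
by move=> /(_ zero); apply.
Qed.

Lemma rank_ge1P A d : rank_ge A one d <-> limit_point A d.
Proof.
split=> [|/rank_ge_one//]; move: {-2}one (erefl one) => m em r.
case: r em => [e e0|//|m' e _ m1 _ em].
  have := elts_one; rewrite -e0 elts_zero => /seteqP[_ /(_ zero)].
  by move=> /(_ erefl).
by move: m1; rewrite em => m1; case: (one_notin_one m1).
Qed.

Lemma rank_ge_gt1P A m d : ordinal m -> one ∈ m ->
  rank_ge A m d <-> forall n, n ∈ m -> limit_point (rank_ge A n) d.
Proof.
move=> om m1; split=> [r|]; last exact: rank_ge_gt1.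
case: r om m1 => // e _; first by rewrite elts_zero.
by move=> _ m1; case: (one_notin_one m1).
Qed.

(* rank(A, d) <= t: every m with rank(A, d) >= m is at most t.                *)
Definition thin (t : V) (A : set V) : Prop :=
  forall d, ordinal d -> forall m, ordinal m -> rank_ge A m d -> m `<=` t.

Definition club_omega1 (C : set V) : Prop :=
  [/\ C `<=` omega1,
      forall a, omega1 a -> exists2 b, C b & a ∈ b &
      forall d, omega1 d -> limit_point C d -> C d].

Definition dot_principle (t l : V) : Prop :=
  forall A : V -> set V,
  (forall i, i ∈ l -> A i `<=` omega1 /\ thin t (A i)) ->
  exists2 C : set V, club_omega1 C & forall i, i ∈ l -> finite_set (C `&` A i).

(* Main.v *)
From Pilot Require (* [zero], [one] and [dense] denote the notions of set theory below. *)
Import Defs.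
From mathcomp Require Import all_boot.
From mathcomp Require Import boolp classical_sets functions cardinality.
Import Defs.

Set Implicit Arguments.
Unset Strict Implicit.
Unset Printing Implicit Defensive.

Local Open Scope classical_set_scope.
Local Open Scope card_scope.

(** The club is added by finite conditions.  A condition is a finite set of
    pairwise disjoint closed intervals of countable ordinals together with a
    finite set of indices [i < lambda].  The left endpoints of the intervals are
    to be the members of the club, and an index [i] is a promise that no new left
    endpoint will be taken from [A i].  It suffices to treat limit ordinals: each [A i]
    is replaced by the set [B i] of its limit ordinals, and the club consists of
    the limit left endpoints.  An ordinal not yet covered can therefore always be
    covered by an interval that starts at a successor or at zero ([cover]); once
    everything is covered, disjointness of the intervals makes the set of limit
    left endpoints closed.  A generic set that contains each index [i] yields a
    club that meets [A i] in finitely many points only.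

    The substance is the chain condition.  Elementary submodels are replaced by
    countable sets closed under one operation with countable values, [skolem].
    Let [p] belong to a model of least [delta] among finitely many models [N].
    The degenerate intervals at the ordinals [delta N] can be added to [p],
    because thin sets are bounded in [omega1] ([thin_bounded]) and the bounds of
    those promised by [p] belong to the least model.  Any condition [q] with the
    degenerate interval at [delta N] is generic for [N] ([model_generic]).
    Indeed, let [D] in [N] be dense, let [r] extend [q], and let [d0] in [D]
    extend [r].  The trace of [d0] on [N] and reflection give, for every
    countable [nu], some [d nu] in [D] that contains the part of [d0] in [N] and
    has its other intervals above [nu].  The difficulty is to find [nu] in [N]
    for which these other intervals start outside the union [E] of the [B i]
    promised by [r], as these indices [i] need not belong to [N].  Here thinness
    enters: [E] is thin ([rank_geU]), and a thin set cannot meet all the intervals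
    from [nu] up to [h nu], for a fixed function [h], as the points closed under
    [h] would be limits of it, their limits would have rank at least 2, and so on.
    How far one must look for a gap depends on [h] and [tau] only, not on the
    thin set ([thin_gap]); so this bound, and thus the gap, is found in [N]. *)

(** * Countable hulls *)

Lemma chain_le T (N : nat -> set T) : (forall n, N n `<=` N n.+1) ->
  forall m n x, (m <= n)%N -> N m x -> N n x.
Proof.
move=> NS m n x /subnKC <- Nx; elim: (n - m)%N => [|k IH]; first by rewrite addn0.
by rewrite addnS; apply: NS.
Qed.

Lemma finite_in_chain T (N : nat -> set T) (s : set T) : (forall n, N n `<=` N n.+1) ->
  finite_set s -> s `<=` \bigcup_n N n -> exists n, s `<=` N n.
Proof.
move=> NS; elim/Pchoice: T => U in N s NS *.
move=> /finite_seqP[l ->]; elim: l => [|x l IH] sN; first by exists 0%N.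
have [m lm] : exists m, [set` l] `<=` N m.
  by apply: IH => y yl; apply: sN; rewrite /= inE yl orbT.
have [k _ xk] : (\bigcup_n N n) x by apply: sN; rewrite /= mem_head.
exists (maxn m k) => y; rewrite /= inE => /orP[/eqP->|/lm yk].
- exact: (chain_le NS (leq_maxr _ _) xk).
- exact: (chain_le NS (leq_maxl _ _) yk).
Qed.

Definition closed_under T (Phi : T -> set T -> set T) (B : set T) : Prop :=
  forall x s, B x -> finite_set s -> s `<=` B -> Phi x s `<=` B.

Lemma closed_under_chain T (Phi : T -> set T -> set T) N : (forall n, N n `<=` N n.+1) ->
  (forall n, closed_under Phi (N n)) -> closed_under Phi (\bigcup_n N n).
Proof.
move=> NS cN x s [k _ xk] fs /(finite_in_chain NS fs)[m sm] y Phiy.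
exists (maxn m k) => //; apply: cN (Phiy) => //.
- exact: (chain_le NS (leq_maxr _ _) xk).
- move=> z /sm zm; exact: (chain_le NS (leq_maxl _ _) zm).
Qed.

(** The downward Loewenheim-Skolem argument: close off in countably many
    stages.  The minimality of the hull keeps it inside a prescribed
    closed class. *)
Lemma countable_hull T (Phi : T -> set T -> set T) (a : set T) :
  (forall x s, finite_set s -> countable (Phi x s)) -> countable a ->
  exists B, [/\ countable B, a `<=` B, closed_under Phi B &
    forall B', a `<=` B' -> closed_under Phi B' -> B `<=` B'].
Proof.
move=> cPhi ca.
pose step B := B `|`
  \bigcup_(x in B) \bigcup_(s in [set s | s `<=` B /\ finite_set s]) Phi x s.
pose N n := iter n step a.
have NS n : N n `<=` N n.+1 by move=> x Nx; left.
exists (\bigcup_n N n); split.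
- apply: bigcup_countable => // n _; elim: n => // n IH.
  have -> : N n.+1 = \bigcup_(b in [set: bool]) if b then N n else
    \bigcup_(x in N n) \bigcup_(s in [set s | s `<=` N n /\ finite_set s]) Phi x s.
    apply/seteqP; split=> [x [Nx|Px]|x [[] _ ?]]; [by exists true|by exists false| |].
    + by left.
    + by right.
  apply: bigcup_countable => // -[] _ //.
  apply: bigcup_countable => // x _; apply: bigcup_countable => [|s [_ fs]].
    exact: countable_finite_subset.
  exact: cPhi.
- by move=> x ax; exists 0%N.
- move=> x s [k _ xk] fs /(finite_in_chain NS fs)[m sm] y Phiy.
  exists (maxn m k).+1 => //; right; exists x.
    exact: (chain_le NS (leq_maxr _ _) xk).
  by exists s => //; split=> // z /sm zm; exact: (chain_le NS (leq_maxl _ _) zm).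
- move=> B' aB' cB' x [n _]; elim: n x => [|n IH] x; first exact: aB'.
  move=> [/IH//|[y Ny [s [sN fs] Py]]].
  by apply: (cB' y s) => //; [exact: IH|move=> z /sN /IH].
Qed.

(** * Sets and ordinals *)

(** The set with the same elements as the class [A], [zero] when [A] is a
    proper class. *)
Definition setof (A : set V) : V := xget (zero : V) [set x : V | elts x = A].

(** An image of a type that may index a tree is a set, and so is every subclass
    of it. *)
Lemma elts_setof (I : Type) (f : I -> V) (A : set V) :
  A `<=` range f -> elts (setof A) = A.
Proof.
move=> Af; rewrite /setof; apply: (@xgetPex V zero [set x : V | elts x = A]).
have [y ey] := separation (fam f) A; exists y => /=.
by rewrite ey elts_fam; apply/setIidPr.
Qed.

Lemma elts_setof_sub (x : V) (A : set V) : A `<=` x -> elts (setof A) = A.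
Proof. by have [I [f ->]] := fam_elts x; rewrite elts_fam; apply: elts_setof. Qed.

Lemma elts_setof_countable (A : set V) : countable A -> elts (setof A) = A.
Proof.
move=> /countable_injP[f finj].
apply: (@elts_setof nat (fun n => xget (zero : V) [set x | A x /\ f x = n])) => x Ax.
exists (f x) => //; apply: xget_unique => // y [Ay /finj]; apply; exact: mem_set.
Qed.

Lemma elts_setof_powerset (x : V) :
  elts (setof [set y : V | y `<=` x]) = [set y : V | y `<=` x].
Proof.
have [I [f ->]] := fam_elts x; rewrite elts_fam.
apply: (@elts_setof (I -> Prop) (fun A => fam (fun i : {i | A i} => f (sval i)))).
move=> y yx; exists (fun i => f i ∈ y) => //; apply: elts_inj; rewrite elts_fam.
apply/seteqP; split=> [_ [[i yi] _ <-]//|z yz].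
by have [i _ fi] := yx z yz; rewrite -fi in yz *; exists (exist _ i yz).
Qed.

Lemma elts_pair (x y z : V) : z ∈ upair x y <-> z = x \/ z = y.
Proof. by rewrite elts_upair. Qed.

Lemma opair_inj x y x' y' : opair x y = opair x' y' -> x = x' /\ y = y'.
Proof.
move=> /(congr1 elts); rewrite !elts_upair => /seteqP[H1 H2].
have upE a b c d : upair a b = upair c d -> [set a; b] = [set c; d].
  by rewrite -!elts_upair => ->.
have xx : x = x'.
  have [|] := H1 (upair x x) (or_introl erefl) => /upE /seteqP[+ _].
  - by move=> /(_ x (or_introl erefl)) [].
  - move=> xx; have [|] := H2 (upair x' x') (or_introl erefl) => /upE /seteqP[]; 
    by move=> _ /(_ x (or_introl erefl))[].
subst x'; split=> //.
have [|] := H1 (upair x y) (or_intror erefl) => /upE /seteqP[s1 s2].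
- have yx : y = x by have [] := s1 y (or_intror erefl).
  have [|] := H2 (upair x y') (or_intror erefl) => /upE /seteqP[t1 _];
    by have [|] := t1 y' (or_intror erefl); rewrite ?yx.
- have [yx|//] := s1 y (or_intror erefl).
  by have [|->//] := s2 y' (or_intror erefl); rewrite yx.
Qed.

Lemma mem_irr (x : V) : ~ x ∈ x.
Proof. by elim/mem_ind: x => x IH xx; apply: (IH x). Qed.

Lemma mem_asym (x y : V) : x ∈ y -> ~ y ∈ x.
Proof.
by elim/mem_ind: x y => x IH y xy yx; apply: (IH y yx x yx xy).
Qed.

Lemma ordinal_mem (a b : V) : ordinal a -> b ∈ a -> ordinal b.
Proof.
move=> [ta ea] ba; split=> [|c cb]; first exact: ea.
exact: ea (ta b ba c cb).
Qed.

Lemma ordinal_trans (a b c : V) : ordinal c -> a ∈ b -> b ∈ c -> a ∈ c.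
Proof. by move=> [tc _] ab bc; apply: (tc b). Qed.

Lemma ordinal_total (a b : V) : ordinal a -> ordinal b ->
  [\/ a ∈ b, a = b | b ∈ a].
Proof.
elim/mem_ind: a b => a IHa; elim/mem_ind => b IHb oa ob.
have [ab|nab] := pselect (a ∈ b); first exact: Or31.
have [ba|nba] := pselect (b ∈ a); first exact: Or33.
apply: Or32; apply: elts_inj; apply/seteqP; split=> x xab.
- have [//|xb|bx] := IHa x xab b (ordinal_mem oa xab) ob.
  + by case: nba; rewrite -xb.
  + by case: nba; apply: ordinal_trans bx xab.
- have [ax|ax|//] := IHb x xab oa (ordinal_mem ob xab).
  + by case: nab; apply: ordinal_trans ax xab.
  + by case: nab; rewrite ax.
Qed.

Lemma ordinal_le (a b : V) : ordinal a -> ordinal b ->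
  a `<=` b <-> a = b \/ a ∈ b.
Proof.
move=> oa ob; split=> [ab|[->//|ab]]; last exact: ob.1.
have [?|?|ba] := ordinal_total oa ob; [by right|by left|].
by case: (mem_irr (ab b ba)).
Qed.

Lemma ordinal_leNgt (a b : V) : ordinal a -> ordinal b ->
  a `<=` b <-> ~ b ∈ a.
Proof.
move=> oa ob; split=> [ab ba|ba]; first exact: (mem_irr (ab b ba)).
by apply/ordinal_le => //; have [|?|] := ordinal_total oa ob; [right|left|].
Qed.

Lemma ordinal_class (A : set V) (a : V) : elts a = A ->
  (forall x, A x -> ordinal x) -> transitive_class A -> ordinal a.
Proof. by move=> ea oA tA; split=> [|b]; rewrite ea // => /oA []. Qed.

Definition succ (a : V) : V := setof (a `|` [set a]).

Lemma elts_succ a : elts (succ a) = a `|` [set a].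
Proof.
have [I [f ef]] := fam_elts a.
apply: (@elts_setof (option I) (fun o => if o is Some i then f i else a)).
move=> x [|->]; last by exists None.
by rewrite {1}ef elts_fam => -[i _ <-]; exists (Some i).
Qed.

Lemma mem_succ (a : V) : a ∈ succ a. Proof. by rewrite elts_succ; right. Qed.

Lemma sub_succ (a : V) : a `<=` succ a. Proof. by rewrite elts_succ; left. Qed.

Lemma ordinal_succ a : ordinal a -> ordinal (succ a).
Proof.
move=> oa; apply: (ordinal_class (elts_succ a)) => [x [|->//]|x [xa|->]].
- exact: ordinal_mem.
- by move=> y yx; left; apply: ordinal_trans yx xa.
- by left.
Qed.

Lemma omega1_ordinal a : omega1 a -> ordinal a. Proof. by case. Qed.

Lemma omega1_countable (a : V) : omega1 a -> countable a. Proof. by case. Qed.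

Lemma omega1_mem (a b : V) : omega1 a -> b ∈ a -> omega1 b.
Proof.
move=> [oa ca] ba; split; first exact: ordinal_mem ba.
by apply: sub_countable ca; apply: subset_card_le; apply: oa.1.
Qed.

Lemma omega1_zero : omega1 zero.
Proof.
split; last by rewrite elts_zero; apply: countable0.
by apply: (ordinal_class elts_zero) => // x.
Qed.

Lemma countableU (T : Type) (A B : set T) :
  countable A -> countable B -> countable (A `|` B).
Proof. by move=> cA cB; rewrite -bigcup2E; apply: bigcup_countable => // -[|[|]]. Qed.

Lemma omega1_succ a : omega1 a -> omega1 (succ a).
Proof.
move=> [oa ca]; split; first exact: ordinal_succ.
by rewrite elts_succ; apply: countableU => //; apply: countable1.
Qed.

Lemma ordinal_zero_mem (a : V) : ordinal a -> a !=set0 -> zero ∈ a.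
Proof.
move=> oa [x xa]; have [//|az|] := ordinal_total (omega1_ordinal omega1_zero) oa.
- by move: xa; rewrite -az elts_zero.
- by rewrite elts_zero.
Qed.

(** Ordinals and ordered pairs are told apart: a nonempty ordinal has the
    empty set as an element, an ordered pair has only nonempty elements. *)
Lemma opair_not_ordinal x y : ~ ordinal (opair x y).
Proof.
move=> /ordinal_zero_mem oz; have : zero ∈ opair x y.
  by apply: oz; exists (upair x x); rewrite elts_upair; left.
rewrite elts_upair => -[] /(congr1 elts); rewrite elts_zero elts_upair;
  by move=> /seteqP[_ /(_ x (or_introl erefl))].
Qed.

Definition limit (a : V) : Prop :=
  a !=set0 /\ forall x, x ∈ a -> succ x ∈ a.

Lemma limit_zero : ~ limit zero.
Proof. by rewrite /limit elts_zero => -[[]]. Qed.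

Lemma limit_succ a : ~ limit (succ a).
Proof. by move=> [_ /(_ a (mem_succ a))]; apply: mem_irr. Qed.

Lemma limit_point_limit (A : set V) (d : V) :
  (forall a, A a -> ordinal a) -> ordinal d -> limit_point A d -> limit d.
Proof.
move=> oA od [d0 Ad]; split=> // x /Ad[e [Ae xe ed]].
have ox : ordinal x by apply: ordinal_mem xe; apply: oA.
have oe := oA _ Ae.
have [se|->//|] := ordinal_total (ordinal_succ ox) oe; first exact: ordinal_trans ed.
rewrite elts_succ => -[ex|ex]; first by case: (mem_asym xe ex).
by move: xe; rewrite ex => /mem_irr.
Qed.

(** The countable ordinals that are closed under a countable-valued operation
    are unbounded: intersect a countable hull with [omega1]. *)
Lemma omega1_closure (Psi : V -> set V) (x : V) :
  (forall z, omega1 z -> countable (Psi z)) -> omega1 x ->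
  exists e, [/\ omega1 e, x ∈ e & forall z, z ∈ e -> Psi z `&` omega1 `<=` e].
Proof.
move=> cPsi ox.
pose Phi z (_ : set V) := [set y : V | omega1 z /\ (y ∈ z \/ Psi z y)].
have cPhi z s : finite_set s -> countable (Phi z s).
  move=> _.
  have [oz|noz] := pselect (omega1 z).
    apply: (@sub_countable _ _ _ (z `|` Psi z)); last first.
      by apply: countableU; [exact: omega1_countable|exact: cPsi].
    by apply: subset_card_le => y [].
  by rewrite (_ : Phi z s = set0) // -subset0 => y [].
have [N [cN xN clN _]] := countable_hull cPhi (countable1 x).
have cD : countable (delta N) by apply: sub_countable cN; apply: subset_card_le => ? [].
have eD := elts_setof_countable cD.
have st z y : delta N z -> y ∈ z \/ Psi z y -> N y.
  by move=> [Nz oz] H; apply: (clN z set0).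
exists (setof (delta N)); split.
- split; last by rewrite eD.
  apply: (ordinal_class eD) => [y [_ /omega1_ordinal//]|y Dy z zy].
  split; first by apply: (st y) => //; left.
  by case: Dy => _ /omega1_mem; apply.
- by rewrite eD; split=> //; apply: xN.
- rewrite eD => z Dz y [Py oy]; split=> //; by apply: (st z) => //; right.
Qed.

Lemma omega1_countable_bound (A : set V) : countable A -> A `<=` omega1 ->
  exists2 e, omega1 e & limit e /\ A `<=` e.
Proof.
move=> cA oA.
have cPsi z : omega1 z -> countable ([set succ z] `|` A).
  by move=> _; apply: countableU => //; apply: countable1.
have [e [oe ze He]] := omega1_closure cPsi omega1_zero.
exists e => //; split; last by move=> y Ay; apply: (He zero) => //; split; [right|apply: oA].
split; first by exists zero.
move=> x xe; apply: (He x) => //; split; first by left.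
by apply: omega1_succ; apply: omega1_mem xe.
Qed.

(** * Cantor-Bendixson ranks *)

Lemma ordinal_one : ordinal one.
Proof.
apply: (ordinal_class elts_one) => [x ->|x -> y]; last by rewrite elts_zero.
exact: omega1_ordinal omega1_zero.
Qed.

Lemma ordinal_01 m : ordinal m -> [\/ m = zero, m = one | one ∈ m].
Proof.
move=> om; have [|->|] := ordinal_total om ordinal_one; last exact: Or33.
- by rewrite elts_one => ->; apply: Or31.
- exact: Or32.
Qed.

Lemma limit_pointS (A B : set V) d : A `<=` B -> limit_point A d -> limit_point B d.
Proof.
by move=> AB [d0 Ad]; split=> // x /Ad[e [/AB]]; exists e.
Qed.

Lemma limit_pointU (A B : set V) d : ordinal d ->
  limit_point (A `|` B) d -> limit_point A d \/ limit_point B d.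
Proof.
move=> od [d0 ABd]; apply: contrapT => /not_orP[nA nB].
have gap C : ~ limit_point C d ->
    exists2 x, x ∈ d & forall e, x ∈ e -> e ∈ d -> ~ C e.
  move=> nC; apply: contrapT => H; apply: nC; split=> // x xd.
  by apply: contrapT => H'; apply: H; exists x => // e xe ed Ce; apply: H'; exists e.
have [x xd Ax] := gap _ nA; have [y yd By] := gap _ nB.
wlog [z [zd xz yz]] : / exists z, [/\ z ∈ d, x `<=` z & y `<=` z].
  have ox := ordinal_mem od xd; have oy := ordinal_mem od yd; apply.
  have [xy|->|yx] := ordinal_total ox oy; [exists y|exists y|exists x]; split=> //.
  - exact: oy.1.
  - exact: ox.1.
have [e [ABe ze ed]] := ABd z zd; have oe := ordinal_mem od ed.
have up w : w ∈ d -> w `<=` z -> w ∈ e.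
  move=> wd /ordinal_le[||->//|wz]; [exact: ordinal_mem wd|exact: ordinal_mem zd|].
  exact: ordinal_trans wz ze.
case: ABe; [exact: Ax (up _ xd xz) ed|exact: By (up _ yd yz) ed].
Qed.

Lemma limit_point_idem (A : set V) d : ordinal d ->
  limit_point (limit_point A) d -> limit_point A d.
Proof.
move=> od [d0 Ad]; split=> // x /Ad[e [[_ Ae] /Ae[a [Aa xa ae]] ed]].
by exists a; split=> //; apply: ordinal_trans ae ed.
Qed.

Lemma rank_ge_inv A m d : rank_ge A m d ->
  [\/ m = zero, m = one /\ limit_point A d |
      [/\ ordinal m, one ∈ m & forall n, n ∈ m -> limit_point (rank_ge A n) d]].
Proof. by case=> [e|e|{}m e om m1 H]; [apply: Or31|move=> H; apply: Or32|apply: Or33]. Qed.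

Lemma rank_ge_ordinal A m d : rank_ge A m d -> ordinal m.
Proof.
move=> /rank_ge_inv[->|[-> _]|[]//]; first exact: omega1_ordinal omega1_zero.
exact: ordinal_one.
Qed.

Lemma rank_geS (A B : set V) m d : A `<=` B -> rank_ge A m d -> rank_ge B m d.
Proof.
move=> AB; elim/mem_ind: m d => m IH d /rank_ge_inv[->|[-> Ad]|[om m1 H]].
- exact: rank_ge_zero.
- by apply: rank_ge_one; apply: limit_pointS Ad.
- by apply: rank_ge_gt1 => // n nm; apply: limit_pointS (H n nm) => e; apply: IH.
Qed.

Lemma rank_ge_le A m n d : ordinal d -> n ∈ m -> rank_ge A m d -> rank_ge A n d.
Proof.
move=> od nm r; have on := ordinal_mem (rank_ge_ordinal r) nm.
case/rank_ge_inv: r nm => [->|[-> _]|[om m1 H] nm].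
- by rewrite elts_zero.
- by rewrite elts_one => ->; apply: rank_ge_zero.
have [->|->|n1] := ordinal_01 on; first exact: rank_ge_zero.
- apply/rank_ge1P; apply: limit_point_idem => //.
  by apply: limit_pointS (H _ m1) => e /rank_ge1P.
- by apply: rank_ge_gt1 => // k kn; apply: H; apply: ordinal_trans kn nm.
Qed.

(** A rank above 1 asks for limits at every smaller rank [n], and each [n] is
    attained through [A] or through [B]; as ranks decrease, the one that works
    for cofinally many [n] works for all. *)
Lemma rank_geU (A B : set V) m d : ordinal d ->
  rank_ge (A `|` B) m d -> rank_ge A m d \/ rank_ge B m d.
Proof.
elim/mem_ind: m d => m IH d od /rank_ge_inv[->|[-> ABd]|[om m1 H]].
- by left; apply: rank_ge_zero.
- by have [|] := limit_pointU od ABd; [left|right]; apply: rank_ge_one.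
have AB n : n ∈ m -> limit_point (rank_ge A n) d \/ limit_point (rank_ge B n) d.
  move=> nm; apply: limit_pointU => //; have [d0 Hn] := H n nm; split=> // x /Hn.
  move=> [e [ABe xe ed]]; exists e; split=> //; apply: IH => //.
  exact: ordinal_mem ed.
have down C n k : k ∈ n -> limit_point (rank_ge C n) d -> limit_point (rank_ge C k) d.
  move=> kn [d0 Cd]; split=> // x /Cd[e [Ce xe ed]]; exists e; split=> //.
  by apply: rank_ge_le kn Ce; apply: ordinal_mem ed.
have [An|/existsNP[n /not_implyP[nm nA]]] :=
    pselect (forall n, n ∈ m -> limit_point (rank_ge A n) d).
  by left; apply: rank_ge_gt1.
right; apply: rank_ge_gt1 => // k km.
have [Ak|//] := AB k km; have [//|Bn] := AB n nm.
have [nk|<-//|kn] := ordinal_total (ordinal_mem om nm) (ordinal_mem om km).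
- by case: nA; apply: down nk Ak.
- exact: down kn Bn.
Qed.

Lemma thin0 t : thin t set0.
Proof.
move=> d _ m _ /rank_ge_inv[->|[_ [[x] + H]]|[_ m1 H]]; first by rewrite elts_zero.
- by move=> /H[e []].
- have [[x] + {}H] := H one m1; move=> /H[e [/rank_ge1P[[y] + He] _ _]].
  by move=> /He[? []].
Qed.

Lemma thinS t (A B : set V) : A `<=` B -> thin t B -> thin t A.
Proof. by move=> AB tB d od m om /(rank_geS AB); apply: tB. Qed.

Lemma thinU t (A B : set V) : thin t A -> thin t B -> thin t (A `|` B).
Proof. by move=> tA tB d od m om /(rank_geU od)[]; [apply: tA|apply: tB]. Qed.

Lemma thin_bigcup t (I : set V) (A : V -> set V) : finite_set I ->
  (forall i, I i -> thin t (A i)) -> thin t (\bigcup_(i in I) A i).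
Proof.
move=> /finite_seqP[l ->]; elim: l => [|j l IH] tA.
  by rewrite set_nil bigcup_set0; apply: thin0.
have -> : [set` j :: l] = j |` [set` l].
  apply/seteqP; split=> x; rewrite /= inE; first by move=> /predU1P[]; [left|right].
  by move=> [->|->]; rewrite ?eqxx ?orbT.
rewrite bigcup_setU1; apply: thinU; first by apply: tA; rewrite /= mem_head.
by apply: IH => i il; apply: tA; rewrite /= inE il orbT.
Qed.

(** If [A] meets each interval from [nu] up to [h nu], then the points closed
    under [h] are limits of [A], the limits of such points have rank at least 2,
    and so on.  The quantifiers carry the weight: the bound [y] is chosen before
    [A], so that it depends on [x], [h] and [mu] only. *)
Lemma rank_unbounded (h : V -> V) (mu : V) : (forall x, omega1 x -> omega1 (h x)) ->
  omega1 mu -> forall x, omega1 x -> exists2 y, omega1 y & forall A : set V,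
    (forall nu, nu ∈ y -> exists a, [/\ A a, nu `<=` a & a ∈ h nu]) ->
    exists e, [/\ x ∈ e, e ∈ y & rank_ge A mu e].
Proof.
move=> oh; elim/mem_ind: mu => mu IH omu x ox.
pose good n x y := omega1 y /\ forall A : set V,
    (forall nu, nu ∈ y -> exists a, [/\ A a, nu `<=` a & a ∈ h nu]) ->
    exists e, [/\ x ∈ e, e ∈ y & rank_ge A n e].
pose Y n x := xget (zero : V) [set y : V | good n x y].
have YP n z : n ∈ mu -> omega1 z -> good n z (Y n z).
  move=> nmu oz; have [y oy Hy] := IH n nmu (omega1_mem omu nmu) z oz.
  by apply: (@xgetPex V zero [set y : V | good n z y]); exists y; split.
(* The base of the induction needs closure under [h], the higher ranks need
   closure under the bounds [Y n] given by the induction hypothesis. *)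
pose Psi z := [set succ z; h (succ z)] `|` (Y^~ z @` mu).
have cPsi z : omega1 z -> countable (Psi z).
  move=> _; apply: countableU; first exact/finite_set_countable/finite_set2.
  apply: sub_countable (card_image_le _ _) _; exact: omega1_countable.
have [e [oe xe He]] := omega1_closure cPsi ox.
have od := omega1_ordinal oe.
exists (succ e); first exact: omega1_succ.
move=> A HA; exists e; split=> //; first exact: mem_succ.
have oe' z : z ∈ e -> omega1 z by apply: omega1_mem.
have succe z : z ∈ e -> succ z ∈ e.
  move=> ze; apply: (He z ze); split; first by left; left.
  exact/omega1_succ/oe'.
have Ye n z : n ∈ mu -> z ∈ e -> Y n z ∈ e.
  move=> nmu ze; apply: (He z ze); split; first by right; exists n.
  by have [] := YP n z nmu (oe' z ze).
have he z : z ∈ e -> h (succ z) ∈ e.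
  move=> ze; apply: (He z ze); split; first by left; right.
  exact/oh/omega1_succ/oe'.
have [->|->|mu1] := ordinal_01 (omega1_ordinal omu); first exact: rank_ge_zero.
- apply: rank_ge_one; split=> [|z ze]; first by exists x.
  have [a [Aa za ah]] := HA (succ z) (sub_succ (succe z ze)).
  exists a; split=> //; first exact: za (mem_succ z).
  exact: ordinal_trans ah (he z ze).
- apply: rank_ge_gt1 (omega1_ordinal omu) mu1 _ => n nmu.
  split=> [|z ze]; first by exists x.
  have [oY] := YP n z nmu (oe' z ze); move=> /(_ A)[nu nuY|w [zw wY Aw]].
    by apply: HA; apply: sub_succ; apply: ordinal_trans nuY (Ye n z nmu ze).
  by exists w; split=> //; apply: ordinal_trans wY (Ye n z nmu ze).
Qed.

(** The bound [y] serves all [t]-thin sets at once; a countable model that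
    contains [y] therefore contains a gap of [A], whether or not it contains [A]. *)
Lemma thin_gap (t : V) (h : V -> V) : omega1 t ->
  (forall x, omega1 x -> omega1 (h x)) ->
  exists2 y, omega1 y & forall A : set V, thin t A ->
    exists2 nu, nu ∈ y & forall a : V, nu `<=` a -> a ∈ h nu -> ~ A a.
Proof.
move=> ot oh; have ost := omega1_succ ot.
have [y oy Hy] := rank_unbounded oh ost omega1_zero; exists y => // A tA.
apply: contrapT => nogap; have [nu nuy|e [_ ey]] := Hy A.
  apply: contrapT => noa; apply: nogap; exists nu => // a nua ah Aa.
  by apply: noa; exists a.
have oe := omega1_ordinal (omega1_mem oy ey).
move=> /(tA e oe _ (omega1_ordinal ost)) /(_ t (mem_succ t)); exact: mem_irr.
Qed.

(** An unbounded [A] has no gap from [nu] up to [h nu] when [h nu] is the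
    successor of a point of [A] at or above [nu]. *)
Lemma thin_bounded (t : V) (A : set V) : omega1 t -> A `<=` omega1 -> thin t A ->
  exists2 y, omega1 y & A `<=` y.
Proof.
move=> ot oA tA; apply: contrapT => unb.
have next nu : omega1 nu -> exists a, A a /\ nu `<=` a.
  move=> onu; apply: contrapT => H; apply: unb; exists nu => // a Aa.
  apply: contrapT => na; apply: H; exists a; split=> //.
  by apply/ordinal_leNgt => //; apply: omega1_ordinal => //; apply: oA.
pose h nu := succ (xget (zero : V) [set a : V | A a /\ nu `<=` a]).
have hP nu : omega1 nu -> exists a, [/\ A a, nu `<=` a & h nu = succ a].
  move=> /next/(@xgetPex V zero [set a : V | A a /\ nu `<=` a])[? ?].
  by eexists; split; last reflexivity.
have [nu onu|y oy /(_ A tA)[nu nuy]] := @thin_gap t h ot.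
  by have [a [Aa _ ->]] := hP nu onu; apply/omega1_succ/oA.
have [a [Aa nua ->]] := hP nu (omega1_mem oy nuy).
by move=> /(_ a nua (mem_succ a)).
Qed.

(** * Hereditary cardinality *)

Lemma mem_wf : well_founded (fun x y : V => x ∈ y).
Proof. by elim/mem_ind => x IH; constructor. Qed.

(** Enumerate [A] along the ordinal [k] by transfinite recursion: either [A] is
    exhausted before [k], or [k] is injected into [A]. *)
Lemma card_le_ordinal_total (A : set V) (k : V) : ordinal k -> A #<= k \/ k #<= A.
Proof.
move=> ok.
pose step x (f : forall y, y ∈ x -> V) : V :=
  xget (zero : V) (A `\` [set z | exists y (yx : y ∈ x), z = f y yx]).
pose f := Fix mem_wf (fun _ => V) step.
have fE x : f x = xget (zero : V) (A `\` f @` x).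
  rewrite /f Fix_eq /step => [|y g h gh]; last first.
    by congr (xget _ (A `\` _)); apply/seteqP; split=> z [w [wy ->]]; exists w, wy.
  congr (xget _ (A `\` _)); apply/seteqP; split=> z [y]; first by case=> yx ->; exists y.
  by move=> yx <-; exists y, yx.
have [[x [xk Ax]]|H] := pselect (exists x, x ∈ k /\ A `<=` f @` x).
  left; apply: card_le_trans (subset_card_le Ax) _.
  by apply: card_le_trans (card_image_le _ _) _; apply: subset_card_le; apply: ok.1.
right; have fP x : x ∈ k -> (A `\` f @` x) (f x).
  move=> xk; rewrite fE; apply: (@xgetPex V zero (A `\` f @` x)).
  apply: contrapT => nA; apply: H; exists x; split=> // a Aa.
  by apply: contrapT => na; apply: nA; exists a.
have finj : {in elts k &, injective f}.
  move=> x y /set_mem xk /set_mem yk fxy.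
  have [xy|//|yx] := ordinal_total (ordinal_mem ok xk) (ordinal_mem ok yk).
  - by have [_ []] := fP y yk; exists x.
  - by have [_ []] := fP x xk; exists y.
have /andP[_ kf] : (f @` k #<= k) && (k #<= f @` k).
  by rewrite -card_eq_le; apply: inj_card_eq.
by apply: card_le_trans kf _; apply: subset_card_le => _ [x /fP[Afx _] <-].
Qed.

Lemma sub_TC (x : V) : x `<=` TC x.
Proof. by move=> y yx T [_]; apply. Qed.

Lemma TC_transitive (x : V) : transitive_class (TC x).
Proof. by move=> y TCy z zy T TP; apply: TP.1 _ (TCy T TP) _ zy. Qed.

Lemma TC_mem (x y : V) : y ∈ x -> TC y `<=` TC x.
Proof.
move=> yx z TCz; apply: TCz; split; first exact: TC_transitive.
by apply: TC_transitive; apply: sub_TC.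
Qed.

Lemma Hset_mem (k x y : V) : Hset k x -> y ∈ x -> Hset k y.
Proof.
move=> [xk kx] /TC_mem /subset_card_le yx; split; first exact: card_le_trans xk.
by move=> ky; apply: kx; apply: card_le_trans yx.
Qed.

(** If [k] were injected into the transitive closure of [x], it would be an
    element of itself. *)
Lemma Hset_succ_card (k x : V) : ordinal k -> succ_card (TC x) `<=` k -> Hset k x.
Proof.
move=> ok xk; have nk : ~ (k #<= TC x) by move=> kx; apply: (@mem_irr k); apply: xk.
by split=> //; have [] := card_le_ordinal_total (TC x) ok.
Qed.

(** * The poset *)

Definition left_end (u : V) : V := xget (zero : V) [set a : V | exists b, u = opair a b].
Definition right_end (u : V) : V := xget (zero : V) [set b : V | exists a, u = opair a b].

Lemma left_end_opair a b : left_end (opair a b) = a.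
Proof. by apply: xget_unique => [|a' [b' /opair_inj[]]//]; exists b. Qed.

Lemma right_end_opair a b : right_end (opair a b) = b.
Proof. by apply: xget_unique => [|b' [a' /opair_inj[]]//]; exists a. Qed.

(** The least strict upper bound of a finite set is not a limit. *)
Lemma finite_nonlimit_bound (S : set V) (g : V) : omega1 g ->
  finite_set S -> S `<=` g ->
  exists x : V, [/\ omega1 x, x `<=` g, ~ limit x & S `<=` x].
Proof.
move=> og /finite_seqP[l ->]; elim: l => [|y l IH] Sg.
  exists zero; split; [exact: omega1_zero| |exact: limit_zero|by []].
  by rewrite elts_zero.
have [|x [ox xg nx lx]] := IH; first by move=> z zl; apply: Sg; rewrite /= inE zl orbT.
have yg : y ∈ g by apply: Sg; rewrite /= mem_head.
have oy := omega1_mem og yg.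
have [yx|nyx] := pselect (y ∈ x).
  by exists x; split=> // z; rewrite /= inE => /predU1P[->|/lx].
exists (succ y); split; [exact: omega1_succ| |exact: limit_succ|].
- by rewrite elts_succ => z [|->//]; apply: (omega1_ordinal og).1.
- move=> z; rewrite /= inE elts_succ => /predU1P[->|/lx zx]; [by right|left].
  have /ordinal_leNgt le := nyx.
  by apply: (le _ _) zx; apply: omega1_ordinal.
Qed.

Section Poset.
Variables (lambda tau : V) (B : V -> set V).
Hypotheses (lambda_ordinal : ordinal lambda) (omega1_lambda : omega1 `<=` lambda).
Hypothesis (tau_omega1 : omega1 tau).
Hypothesis B_omega1 : forall i, i ∈ lambda -> B i `<=` omega1.
Hypothesis B_limit : forall i, i ∈ lambda -> B i `<=` limit.
Hypothesis B_thin : forall i, i ∈ lambda -> thin tau (B i).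

Definition bound (i : V) : V := xget (zero : V) [set y : V | omega1 y /\ B i `<=` y].

Lemma boundP i : i ∈ lambda -> omega1 (bound i) /\ B i `<=` bound i.
Proof.
move=> il; apply: (@xgetPex V zero [set y : V | omega1 y /\ B i `<=` y]).
by have [y oy By] := thin_bounded tau_omega1 (B_omega1 il) (B_thin il); exists y.
Qed.

(** An ordered pair codes the closed interval between its components.  The
    indices in a condition are the elements of [lambda] themselves: as ordinals
    they differ from all ordered pairs. *)
Definition interval : set V :=
  [set u | exists a b : V, [/\ omega1 a, omega1 b, a `<=` b & u = opair a b]].

Definition disjoint_intervals (P Q : set V) : Prop :=
  forall a b a' b', P (opair a b) -> Q (opair a' b') ->
  [\/ a = a' /\ b = b', b ∈ a' | b' ∈ a].

Definition condition (P : set V) : Prop :=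
  [/\ finite_set P, P `<=` lambda `|` interval & disjoint_intervals P P].

(** No left endpoint of an interval in [Q] but not in [P] lies in a [B i] whose
    index [i] is in [P]. *)
Definition stronger (Q P : set V) : Prop :=
  P `<=` Q /\ forall a b i, Q (opair a b) -> P i -> i ∈ lambda -> B i a ->
  P (opair a b).

Lemma opair_notin a b : ~ opair a b ∈ lambda.
Proof. by move=> /(ordinal_mem lambda_ordinal)/opair_not_ordinal. Qed.

Lemma condition_interval P a b : condition P -> P (opair a b) ->
  [/\ omega1 a, omega1 b & a `<=` b].
Proof.
move=> [_ PA _] /PA[/opair_notin//|[a' [b' [oa ob ab]]]].
by move=> /opair_inj[-> ->].
Qed.

Lemma stronger_refl P : stronger P P. Proof. by split. Qed.

Lemma stronger_trans Q P S : stronger Q P -> stronger P S -> stronger Q S.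
Proof.
move=> [PQ QP] [SP PS]; split=> [x /SP/PQ//|a b i Qab Si il Ba].
by apply: (PS a b i) => //; apply: (QP a b i) => //; apply: SP.
Qed.

Lemma condition_setU P Q : condition P -> condition Q -> disjoint_intervals P Q ->
  condition (P `|` Q).
Proof.
move=> [fP lP dP] [fQ lQ dQ] dPQ; split.
- by rewrite finite_setU.
- by move=> x [/lP|/lQ].
- move=> a b a' b' [Pab|Qab] [Pab'|Qab']; [exact: dP|exact: dPQ| |exact: dQ].
  by have [[-> ->]|?|?] := dPQ _ _ _ _ Pab' Qab; [apply: Or31|apply: Or33|apply: Or32].
Qed.

Lemma condition0 : condition set0.
Proof. by split. Qed.

Lemma condition_index i : i ∈ lambda -> condition [set i].
Proof.
move=> il; split=> [//|_ ->|a b a' b' abi]; first by left.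
by case: (@opair_notin a b); rewrite abi.
Qed.

Lemma condition_singleton a b : omega1 a -> omega1 b -> a `<=` b ->
  condition [set opair a b].
Proof.
move=> oa ob ab; split=> [//|_ ->|c d c' d' /opair_inj[-> ->] /opair_inj[-> ->]].
- by right; exists a, b.
- exact: Or31.
Qed.

Definition same_indices (Q P : set V) : Prop :=
  forall i, i ∈ lambda -> Q i -> P i.

Lemma add_interval P a b : condition P -> omega1 a -> omega1 b -> a `<=` b ->
  (forall a' b', P (opair a' b') -> b' ∈ a \/ b ∈ a') ->
  (forall i, P i -> i ∈ lambda -> ~ B i a) ->
  [/\ condition (P `|` [set opair a b]), stronger (P `|` [set opair a b]) P &
      same_indices (P `|` [set opair a b]) P].
Proof.
move=> cP oa ob ab dP nB; split.
- apply: condition_setU => //; first exact: condition_singleton.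
  move=> a' b' _ _ Pab /opair_inj[-> ->].
  by have [?|?] := dP _ _ Pab; [apply: Or32|apply: Or33].
- split=> [x|c d i [//|/opair_inj[-> _]] Pi il Ba]; first by left.
  by case: (nB i Pi il).
- by move=> i il [//|ii]; case: (@opair_notin a b); rewrite -ii.
Qed.

(** If no interval covers [g], then one that ends at [g] and starts just after
    all intervals below [g] may be added.  No promise is broken: it starts at
    a successor or at [zero], and the sets [B i] consist of limit ordinals. *)
Lemma cover P g : condition P -> omega1 g ->
  exists Q, [/\ condition Q, stronger Q P, same_indices Q P &
    exists a b : V, [/\ Q (opair a b), a `<=` g & g `<=` b]].
Proof.
move=> cP og.
have [[a [b [Pab ag gb]]]|nP] :=
    pselect (exists a b : V, [/\ P (opair a b), a `<=` g & g `<=` b]).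
  by exists P; split; [|exact: stronger_refl|move=> i|exists a, b].
have [fP _ _] := cP.
have fS : finite_set (g `&` right_end @` P).
  by apply: sub_finite_set (finite_image right_end fP) => x [].
have [x [ox xg nx Sx]] := finite_nonlimit_bound og fS (@subIsetl _ _ _).
have [a b Pab|i Pi il Bx|cQ QP sQ] := add_interval cP ox og xg.
- have [oa ob ab] := condition_interval cP Pab.
  have [ga|nga] := pselect (g ∈ a); first by right.
  left; apply: Sx; split; last by exists (opair a b) => //; apply: right_end_opair.
  apply: contrapT => nbg; apply: nP; exists a, b.
  by split=> //; apply/ordinal_leNgt => //; apply: omega1_ordinal.
- exact: nx (B_limit il Bx).
- exists (P `|` [set opair x g]); split=> //; exists x, g; split=> //; by right.
Qed.

Lemma add_point P e : condition P -> omega1 e ->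
  (forall a b, P (opair a b) -> b ∈ e) ->
  (forall i, P i -> i ∈ lambda -> bound i ∈ e) ->
  [/\ condition (P `|` [set opair e e]), stronger (P `|` [set opair e e]) P &
      same_indices (P `|` [set opair e e]) P].
Proof.
move=> cP oe Pe be; apply: add_interval => //; first by left; apply: (Pe a').
move=> i Pi il Be; have [_ Bb] := boundP il.
exact: mem_asym (Bb e Be) (be i Pi il).
Qed.

Lemma add_limit_above P g : condition P -> omega1 g ->
  exists Q, [/\ condition Q, stronger Q P, same_indices Q P &
    exists a b : V, [/\ Q (opair a b), limit a & g ∈ a]].
Proof.
move=> cP og; have [fP _ _] := cP.
pose S := ([set g] `|` (omega1 `&` right_end @` P)) `|` (bound @` (P `&` lambda)).
have cS : countable S.
  apply: finite_set_countable; rewrite !finite_setU; split; first split=> //.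
    by apply: finite_setIr; apply: finite_image.
  by apply: finite_image; apply: finite_setIl.
have oS : S `<=` omega1.
  by move=> x [[->|[]]|[i [_ il] <-]] //; have [] := boundP il.
have [e oe [le Se]] := omega1_countable_bound cS oS.
have [a b Pab|i Pi il|cQ QP sQ] := add_point cP oe.
- have [_ ob _] := condition_interval cP Pab.
  apply: Se; left; right; split=> //; exists (opair a b) => //; exact: right_end_opair.
- by apply: Se; right; exists i.
- exists (P `|` [set opair e e]); split=> //; exists e, e; split=> //; first by right.
  by apply: Se; left; left.
Qed.

Definition posetX : V := setof [set p : V | condition p].

Definition posetR : V := setof
  [set z | exists p q : V, [/\ condition p, condition q, stronger p q & z = opair p q]].

Lemma elts_base : elts (setof (lambda `|` interval)) = lambda `|` interval.
Proof.
have [I [f ef]] := fam_elts lambda.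
have lf : elts lambda = range f by rewrite ef elts_fam.
apply: (@elts_setof (I + I * I)%type
  (fun c => match c with inl i => f i | inr (i, j) => opair (f i) (f j) end)).
move=> x [|[a [b [oa ob _ ->]]]]; first by rewrite lf => -[i _ <-]; exists (inl i).
have := omega1_lambda oa; have := omega1_lambda ob; rewrite lf => -[j _ <-] [i _ <-].
by exists (inr (i, j)).
Qed.

Lemma elts_posetX : elts posetX = [set p : V | condition p].
Proof.
apply: (@elts_setof_sub (setof [set p : V | p `<=` setof (lambda `|` interval)])).
by rewrite elts_setof_powerset elts_base => p [].
Qed.

Lemma posetXP (p : V) : p ∈ posetX <-> condition p.
Proof. by rewrite elts_posetX. Qed.

Lemma elts_condition P : condition P -> elts (setof P) = P.
Proof. by move=> [fP _ _]; apply/elts_setof_countable/finite_set_countable. Qed.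

Lemma posetX_setof P : condition P -> setof P ∈ posetX.
Proof. by move=> cP; apply/posetXP; rewrite elts_condition. Qed.

Lemma elts_posetR : elts posetR =
  [set z | exists p q : V, [/\ condition p, condition q, stronger p q & z = opair p q]].
Proof.
have [I [f ef]] := fam_elts posetX.
apply: (@elts_setof (I * I)%type (fun c => opair (f c.1) (f c.2))).
move=> _ [p [q [/posetXP + /posetXP + _ ->]]]; rewrite ef elts_fam.
by move=> [i _ <-] [j _ <-]; exists (i, j).
Qed.

Lemma extendsP (p q : V) :
  extends posetR p q <-> [/\ condition p, condition q & stronger p q].
Proof.
rewrite /extends elts_posetR; split=> [[p' [q' [? ? ? /opair_inj[-> ->]]]]//|[? ? ?]].
by exists p, q.
Qed.

Lemma posetP : poset posetX posetR.
Proof.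
split.
- by exists (setof set0); apply: posetX_setof; apply: condition0.
- move=> z; rewrite elts_posetR => -[p [q [cp cq _ ->]]]; exists p, q.
  by split=> //; apply/posetXP.
- by move=> p /posetXP cp; apply/extendsP; split=> //; apply: stronger_refl.
- move=> p q /extendsP[_ _ [qp _]] /extendsP[_ _ [pq _]].
  by apply: elts_inj; apply/seteqP.
- move=> p q r /extendsP[cp _ pq] /extendsP[_ cr qr]; apply/extendsP; split=> //.
  exact: stronger_trans pq qr.
Qed.

(** * Genericity *)

(** The reflected properties of a condition: with [s] the part of [d0] in a model
    [N], [d0] itself fits [s] and each [nu] in [N]. *)
Definition fits (D : V) (s : set V) (nu d : V) : Prop :=
  [/\ d ∈ D, s `<=` d &
      forall a b : V, opair a b ∈ d -> s (opair a b) \/ nu `<=` a].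

Definition avoids (D : V) (s E : set V) (d : V) : Prop :=
  [/\ d ∈ D, s `<=` d & forall a b, opair a b ∈ d -> s (opair a b) \/ ~ E a].

(** The Skolem function needed for genericity, with countable sets as values:
    either a level [nu] at which nothing in [D] fits [s], or enough elements of
    [D] that fit [s] to avoid every thin set. *)
Definition witnesses (D : V) (s W : set V) : Prop :=
  [/\ countable W, W `<=` omega1 `|` D & D `<=` posetX ->
      (exists nu, [/\ W nu, omega1 nu & forall d, ~ fits D s nu d]) \/
      forall E : set V, thin tau E -> exists2 d, W d & avoids D s E d].

(** If each [nu] has a [c nu] that fits it, let [h nu] exceed the left endpoints
    in [c nu].  When [nu] starts a gap of [E] up to [h nu], the intervals of
    [c nu] that are not in [s] start in that gap. *)
Lemma witnesses_exist D s : exists W, witnesses D s W.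
Proof.
have [DX|nDX] := pselect (D `<=` posetX); last first.
  by exists set0; split=> //; apply: countable0.
have [[nu onu nfit]|nex] := pselect (exists2 nu, omega1 nu & forall d, ~ fits D s nu d).
  exists [set nu]; split; [exact: countable1|by move=> _ ->; left|].
  by move=> _; left; exists nu.
pose c (nu : V) : V := xget (zero : V) [set d : V | fits D s nu d].
have cP nu : omega1 nu -> fits D s nu (c nu).
  move=> onu; apply: (@xgetPex V zero [set d : V | fits D s nu d]).
  apply: contrapT => nfit; apply: nex; exists nu => // d fd; apply: nfit; by exists d.
pose h (nu : V) : V := xget (zero : V)
  [set y : V | omega1 y /\ forall a b, opair a b ∈ c nu -> a ∈ y].
have hP nu : omega1 nu -> omega1 (h nu) /\ forall a b, opair a b ∈ c nu -> a ∈ h nu.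
  move=> onu; apply: (@xgetPex V zero
    [set y : V | omega1 y /\ forall a b, opair a b ∈ c nu -> a ∈ y]).
  have [/DX/posetXP cd _ _] := cP nu onu; have [fd _ _] := cd.
  have [|y oy [_ Ly]] :=
      @omega1_countable_bound (omega1 `&` left_end @` c nu) _ (@subIsetl _ _ _).
    by apply/finite_set_countable/finite_setIr/finite_image.
  exists y; split=> // a b ab; have [oa _ _] := condition_interval cd ab.
  by apply: Ly; split=> //; exists (opair a b) => //; apply: left_end_opair.
have [y oy gap] := thin_gap tau_omega1 (fun nu onu => (hP nu onu).1).
exists (c @` y); split.
- exact: sub_countable (card_image_le _ _) (omega1_countable oy).
- by move=> _ [nu /(omega1_mem oy) /cP[? _ _] <-]; right.
- move=> _; right=> E /gap[nu nuy nE]; exists (c nu); first by exists nu.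
  have onu := omega1_mem oy nuy; have [Dc sc fc] := cP nu onu; split=> // a b ab.
  have [|nua] := fc a b ab; [by left|right].
  by apply: nE => //; apply: (hP nu onu).2 ab.
Qed.

Definition witness_set (D : V) (s : set V) : set V :=
  sval (cid (witnesses_exist D s)).

Lemma witness_setP D s : witnesses D s (witness_set D s).
Proof. exact: svalP (cid (witnesses_exist D s)). Qed.

(** Closure under the four clauses stands in for elementarity: countable
    elements are subsets, bounds of the thin sets, codes of intervals, and
    witnesses for genericity. *)
Definition skolem (x : V) (s : set V) : set V :=
  [set y | [\/ countable x /\ y ∈ x, x ∈ lambda /\ y = bound x,
     exists z : V, [/\ s z, omega1 x, omega1 z, x `<=` z & y = opair x z] |
     witness_set x s y]].

Lemma skolem_countable x s : finite_set s -> countable (skolem x s).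
Proof.
move=> fs.
pose S := ([set y | countable x /\ y ∈ x] `|` [set bound x]) `|`
  (opair x @` s `|` witness_set x s).
apply: (@sub_countable _ _ _ S).
  apply: subset_card_le => y [xy|[_ ->]|[z [sz _ _ _ ->]]|Wy].
  - by left; left.
  - by left; right.
  - by right; left; exists z.
  - by right; right.
apply: countableU; apply: countableU.
- have [cx|ncx] := pselect (countable x).
    by apply: sub_countable cx; apply: subset_card_le => y [].
  rewrite (_ : [set y | _] = set0); first exact: countable0.
  by rewrite -subset0 => y [].
- exact: countable1.
- exact/finite_set_countable/finite_image.
- by have [] := witness_setP x s.
Qed.

Section Model.
Variables (N : set V) (N_countable : countable N) (N_closed : closed_under skolem N).

Lemma model_elts x : N x -> countable x -> x `<=` N.
Proof. by move=> Nx cx y yx; apply: (N_closed Nx (finite_set0 V)) => //; apply: Or41. Qed.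

Lemma model_bound i : N i -> i ∈ lambda -> delta N (bound i).
Proof.
move=> Ni il; split; last by have [] := boundP il.
by apply: (N_closed Ni (finite_set0 V)) => //; apply: Or42.
Qed.

Lemma model_opair a b : delta N a -> delta N b -> a `<=` b -> N (opair a b).
Proof.
move=> [Na oa] [Nb ob] ab; apply: (N_closed Na (finite_set1 b)) => [_ ->//|].
by apply: Or43; exists b.
Qed.

Lemma model_witness D s : N D -> finite_set s -> s `<=` N -> witness_set D s `<=` N.
Proof. by move=> ND fs sN y Wy; apply: (N_closed ND fs sN); apply: Or44. Qed.

Lemma elts_delta : elts (setof (delta N)) = delta N.
Proof.
apply: elts_setof_countable.
by apply: sub_countable N_countable; apply: subset_card_le => x [].
Qed.

Lemma delta_omega1 : omega1 (setof (delta N)).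
Proof.
split; last first.
  by rewrite elts_delta; apply: sub_countable N_countable; apply: subset_card_le => x [].
apply: (ordinal_class elts_delta) => [x [_ /omega1_ordinal//]|x [Nx ox] y yx].
split; last exact: omega1_mem yx.
by apply: model_elts yx => //; apply: omega1_countable.
Qed.

Lemma model_interval p a b : condition p -> p `<=` N -> p (opair a b) ->
  delta N a /\ delta N b.
Proof.
move=> cp pN pab; have [oa ob _] := condition_interval cp pab.
have ab_sub : opair a b `<=` N.
  apply: model_elts; first exact: pN.
  by apply: finite_set_countable; rewrite elts_upair; apply: finite_set2.
have ab : upair a b `<=` N.
  apply: model_elts; first by apply: ab_sub; apply/elts_pair; right.
  by apply: finite_set_countable; rewrite elts_upair; apply: finite_set2.
by split; split=> //; apply: ab; apply/elts_pair; [left|right].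
Qed.

Lemma model_condition (p : V) : N p -> condition p -> p `<=` N.
Proof. by move=> Np [fp _ _]; apply: model_elts => //; apply: finite_set_countable. Qed.

(** Let [r] extend [q] and [d0] in [D] extend [r].  Because of the interval
    at [delta N], every interval of [d0] either belongs to [N] or starts at or above
    [delta N], so [d0] fits [d0 `&` N] and every [nu] of [N].  The failure of
    [fits] at some [nu] would be witnessed in [N]; hence [N] contains a [d] in
    [D] that avoids the union of the thin sets promised by [r]. *)
Lemma model_generic (q : V) : condition q ->
  opair (setof (delta N)) (setof (delta N)) ∈ q -> generic N posetX posetR q.
Proof.
set e := setof (delta N) => cq qe r /extendsP[cr _ rq] D ND [DX denseD].
have oe : omega1 e := delta_omega1.
have ordE := omega1_ordinal oe.
have eE x : x ∈ e <-> delta N x by rewrite elts_delta.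
have [d0 Dd0 /extendsP[c0 _ d0r]] := denseD r (proj2 (posetXP r) cr).
have d0e : opair e e ∈ d0 by apply: d0r.1; apply: rq.1.
have split0 a b : opair a b ∈ d0 -> N (opair a b) \/ e `<=` a.
  move=> ab; have [oa ob le_ab] := condition_interval c0 ab.
  have [_ _ dj] := c0; have [[-> _]|be|ea] := dj _ _ _ _ ab d0e.
  - by right.
  - left; apply: model_opair => //; last exact/eE.
    apply/eE; have /ordinal_le[//||->//|ab'] := le_ab; try exact: omega1_ordinal.
    exact: ordinal_trans ab' be.
  - by right; apply: (omega1_ordinal oa).1.
pose s := d0 `&` N.
have fs : finite_set s by apply: finite_setIl; case: c0.
have sN : s `<=` N by move=> x [].
have [_ _ /(_ DX)[[nu [Wnu onu nfit]]|avoid]] := witness_setP D s.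
  case: (nfit d0); split=> // [x []//|a b ab].
  have [Nab|ea] := split0 a b ab; first by left.
  right; apply: subset_trans ea; apply: ordE.1; apply/eE; split=> //.
  exact: model_witness Wnu.
pose E := \bigcup_(i in r `&` lambda) B i.
have tE : thin tau E.
  apply: thin_bigcup => [|i [_ il]]; last exact: B_thin.
  by apply: finite_setIl; case: cr.
have [d Wd [Dd sd dE]] := avoid E tE.
have Nd : N d by apply: model_witness Wd.
have cd : condition d by apply/posetXP; apply: DX.
have dN := model_condition Nd cd.
have r_split a b : opair a b ∈ r -> opair a b ∈ d \/ e `<=` a.
  move=> ab; have ab0 := d0r.1 _ ab.
  by have [Nab|] := split0 a b ab0; [left; apply: sd|right].
have crd : condition (d `|` r).
  apply: condition_setU => // a b a' b' ab ab'.
  have [ab'd|ea] := r_split a' b' ab'; first by have [_ _ ] := cd; apply.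
  by apply: Or32; apply: ea; apply/eE; have [] := model_interval cd dN ab.
exists d; split=> //; exists (setof (d `|` r)).
split; apply/extendsP; rewrite elts_condition //; split=> //; split.
- by move=> x; left.
- move=> a b i [//|ab] di il Ba; have [//|ea] := r_split a b ab.
  have [_ Bb] := boundP il.
  have be : bound i ∈ e by apply/eE; apply: model_bound => //; apply: dN.
  by case: (mem_asym (Bb a Ba) (ea _ be)).
- by move=> x; right.
- move=> a b i [ab|//] ri il Ba; have [s_ab|nE] := dE a b ab.
    by apply: d0r.2 Ba => //; case: s_ab.
  by case: nE; exists i.
Qed.

End Model.

(** * The chain condition *)

(** The singleton of a coded interval is a condition, so the interval is in the
    transitive closure of the poset. *)
Lemma interval_Hset k a b : Hset k (opair posetX posetR) ->
  omega1 a -> omega1 b -> a `<=` b -> Hset k (opair a b).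
Proof.
move=> HP oa ob ab.
have HX : Hset k posetX.
  apply: (@Hset_mem k (upair posetX posetX)); last by apply/elts_pair; left.
  by apply: Hset_mem HP _; apply/elts_pair; left.
have Hp : Hset k (setof [set opair a b]).
  by apply: Hset_mem HX _; apply: posetX_setof; apply: condition_singleton.
by apply: Hset_mem Hp _; rewrite elts_setof_countable //; apply: countable1.
Qed.

Lemma countable_ordinal_Hset k a : Hset k (opair posetX posetR) -> omega1 a -> Hset k a.
Proof.
move=> HP oa; apply: (@Hset_mem k (upair a a)); last by apply/elts_pair; left.
have Ho : Hset k (opair a a) by apply: interval_Hset.
by apply: Hset_mem Ho _; apply/elts_pair; left.
Qed.

Lemma Hset_closed k : Hset k (opair posetX posetR) -> closed_under skolem (Hset k).
Proof.
move=> HP x s Hx fs sH y [[_ yx]|[il ->]|[z [_ ox oz xz ->]]|Wy].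
- exact: Hset_mem yx.
- by apply: countable_ordinal_Hset => //; have [] := boundP il.
- exact: interval_Hset.
- have [_ /(_ y Wy)[oy|yx] _] := witness_setP x s; last exact: Hset_mem yx.
  exact: countable_ordinal_Hset.
Qed.

Definition models (k : V) : set (set V) :=
  [set N | [/\ ctble_subsets (Hset k) N, closed_under skolem N & N (opair posetX posetR)]].

Lemma models_club k : Hset k (opair posetX posetR) -> club_subsets (Hset k) (models k).
Proof.
move=> HP; split=> [N []//|a [aH anat]|N mN NS].
- have ca : countable ([set opair posetX posetR] `|` a).
    apply: countableU; first exact: countable1.
    by move: anat; rewrite card_eq_le => /andP[].
  have [N [cN aN clN minN]] := countable_hull skolem_countable ca.
  exists N; last by move=> x ax; apply: aN; right.
  split=> //; last by apply: aN; left.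
  split; first by apply: minN; [move=> x [->|/aH]|apply: Hset_closed].
  rewrite card_eq_le; apply/andP; split; first exact: cN.
  move: anat; rewrite card_eq_le => /andP[_ /card_le_trans]; apply.
  by apply: subset_card_le => x ax; apply: aN; right.
- split; last by exists 0%N => //; have [] := mN 0%N.
  + split; first by move=> x [n _ Nx]; have [[NH _] _ _] := mN n; apply: NH.
    rewrite card_eq_le; apply/andP; split.
      apply: bigcup_countable => // n _; have [[_ +] _ _] := mN n.
      by rewrite card_eq_le => /andP[].
    have [[_ +] _ _] := mN 0%N; rewrite card_eq_le => /andP[_ /card_le_trans]; apply.
    by apply: subset_card_le => x Nx; exists 0%N.
  + by apply: closed_under_chain => // n; have [] := mN n.
Qed.

(** The condition [p] is a finite subset of a model with the least [delta], so
    all its intervals and all bounds of its thin sets lie below every [delta N i],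
    and the one-point intervals at the [delta N i] may be added to it. *)
Lemma poset_aleph15_cc : aleph15_cc posetX posetR.
Proof.
move=> k [[ok _] _ _] Pk; have HP := Hset_succ_card ok Pk.
exists (models k); split; first exact: models_club.
  move=> N [[_ cN] clN NP]; split=> //.
  have {}cN : countable N by move: cN; rewrite card_eq_le => /andP[].
  by exists (setof (delta N)); [have [] := delta_omega1 cN clN|apply: elts_delta].
move=> n N mN p /posetXP cp [j Njp min_j].
have cN i : countable (N i).
  by have [[_ +] _ _] := mN i; rewrite card_eq_le => /andP[].
have clN i : closed_under skolem (N i) by have [] := mN i.
pose e i := setof (delta (N i)); pose Q := [set opair (e i) (e i) | i in [set: 'I_n]].
have oe i : omega1 (e i) := delta_omega1 (cN i) (clN i).
have eE i x : x ∈ e i <-> delta (N i) x by rewrite elts_delta.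
have pN : p `<=` N j := model_condition (clN j) Njp cp.
have cQ : condition Q.
  split; first exact: finite_image.
    by move=> _ [i _ <-]; right; exists (e i), (e i); split.
  move=> a b a' b' [i _ /opair_inj[<- <-]] [i' _ /opair_inj[<- <-]].
  have [?|?|?] := ordinal_total (omega1_ordinal (oe i)) (omega1_ordinal (oe i')).
  - exact: Or32.
  - exact: Or31.
  - exact: Or33.
have cpQ : condition (p `|` Q).
  apply: condition_setU => // a b a' b' ab [i _ /opair_inj[<- <-]].
  apply: Or32; apply/eE; apply: min_j.
  by have [] := model_interval (clN j) cp pN ab.
exists (setof (p `|` Q)); last first.
  move=> i; apply: model_generic; rewrite ?elts_condition //.
  by right; exists i.
apply/extendsP; rewrite elts_condition //; split=> //; split; first by move=> x; left.
move=> a b i [//|[i' _ /opair_inj[<- _]]] pi il Be; have [_ Bb] := boundP il.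
case: (mem_asym (Bb _ Be)); apply/eE; apply: min_j.
by apply: model_bound => //; apply: pN.
Qed.

(** * The club *)

(** One dense set for each index: it decides the index, and, when the index is a
    countable ordinal, covers it and puts a limit point above it. *)
Definition goal (i : V) : set V := [set p : V | [/\ condition p, i ∈ p & omega1 i ->
  (exists a b : V, [/\ opair a b ∈ p, a `<=` i & i `<=` b]) /\
  (exists a b : V, [/\ opair a b ∈ p, limit a & i ∈ a])]].

Lemma elts_goal i : elts (setof (goal i)) = goal i.
Proof. by apply: (@elts_setof_sub posetX) => p [cp _ _]; apply/posetXP. Qed.

Lemma goal_below P i : condition P -> i ∈ lambda ->
  exists p : V, [/\ goal i p, stronger p P &
    forall j, j ∈ lambda -> j ∈ p -> P j \/ j = i].
Proof.
move=> cP il.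
have cPi : condition (P `|` [set i]).
  apply: condition_setU => //; first exact: condition_index.
  by move=> a b a' b' _ abi; case: (@opair_notin a' b'); rewrite abi.
have Pi : stronger (P `|` [set i]) P.
  split=> [x|a b j [//|abi]]; first by left.
  by case: (@opair_notin a b); rewrite abi.
have [oi|noi] := pselect (omega1 i); last first.
  by exists (setof (P `|` [set i])); rewrite /goal /= elts_condition //; split=> //;
    split=> //; right.
have [Q [cQ QP sQ [a [b [Qab ai ib]]]]] := cover cPi oi.
have [S [cS SQ sS [a' [b' [Sab la ia]]]]] := add_limit_above cQ oi.
exists (setof S); rewrite /goal /= elts_condition //; split.
- split=> //; first by apply: SQ.1; apply: QP.1; right.
  by move=> _; split; [exists a, b; split=> //; apply: SQ.1|exists a', b'].
- exact: stronger_trans SQ (stronger_trans QP Pi).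
- by move=> j jl /(sS j jl)/(sQ j jl).
Qed.

Lemma goal_dense i : i ∈ lambda -> dense posetX posetR (setof (goal i)).
Proof.
move=> il; split; first by rewrite elts_goal => p [cp _ _]; apply/posetXP.
move=> p /posetXP cp; have [d [gd dp _]] := goal_below cp il.
exists d; first by rewrite elts_goal.
by apply/extendsP; split=> //; case: gd.
Qed.

(** Two goals differ because [i] can be met without adding another index; so
    there are exactly [lambda] many. *)
Lemma goal_inj : {in elts lambda &, injective (fun i => setof (goal i))}.
Proof.
move=> i j /set_mem il /set_mem jl /(congr1 elts); rewrite !elts_goal => gij.
have [p [gp _ ind]] := goal_below condition0 il.
have [_ jp _] : goal j p by rewrite -gij.
by have [//|->] := ind j jl jp.
Qed.

(** Closure: a limit [d] of the generic set is covered by some interval.  If this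
    starts below [d], then so does a later interval with its left endpoint
    strictly between, which contradicts disjointness. *)
Lemma club_from_MA : MA15 lambda ->
  exists C : set V, [/\ club_omega1 C, C `<=` limit &
    forall i, i ∈ lambda -> finite_set (C `&` B i)].
Proof.
move=> MA.
have [||G [GX [p0 Gp0] _ Gdir] Gdense] :=
    MA _ _ posetP poset_aleph15_cc ((fun i => setof (goal i)) @` lambda).
- exact: inj_card_eq goal_inj.
- by move=> _ [i il <-]; apply: goal_dense.
have Ggoal i : i ∈ lambda -> exists2 p, G p & goal i p.
  move=> il; have [|p [Gp]] := Gdense (setof (goal i)); first by exists i.
  by rewrite elts_goal; exists p.
pose C := [set a : V | limit a /\ exists b p : V, G p /\ opair a b ∈ p].
have common p q : G p -> G q -> exists r : V, [/\ condition r, stronger r p & stronger r q].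
  move=> Gp Gq; have [r [_ /extendsP[cr _ rp] /extendsP[_ _ rq]]] := Gdir p q Gp Gq.
  by exists r.
have Cone : C `<=` omega1.
  move=> a [_ [b [p [/GX/posetXP cp pab]]]].
  by have [] := condition_interval cp pab.
exists C; split; [split=> //|by move=> a []|].
- move=> g og; have [p Gp [_ _ /(_ og)[_ [a [b [pab la ga]]]]]] := Ggoal g (omega1_lambda og).
  by exists a => //; split=> //; exists b, p.
- move=> d od Cd; have ordd := omega1_ordinal od.
  have ld : limit d.
    by apply: limit_point_limit Cd => // a /Cone/omega1_ordinal.
  have [p Gp [cp _ /(_ od)[[a [b [pab ad db]]] _]]] := Ggoal d (omega1_lambda od).
  have [oa ob _] := condition_interval cp pab.
  have [ead|/Cd.2[a' [[_ [b' [q [Gq qab]]]] aa' a'd]]] :=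
    (proj1 (ordinal_le (omega1_ordinal oa) ordd) ad); first by split=> //; exists b, p; rewrite -ead.
  have [r [[_ _ dj] [pr _] [qr _]]] := common p q Gp Gq.
  have [[eq_a _]|ba'|b'a] := dj _ _ _ _ (pr _ pab) (qr _ qab).
  + by move: aa'; rewrite -eq_a => /mem_irr.
  + by case: (mem_asym ba'); apply: db.
  + have [oa' _ a'b'] : [/\ omega1 a', omega1 b' & a' `<=` b'].
      by apply: condition_interval qab; apply/posetXP/GX.
    by case: (@mem_irr b'); apply: a'b'; apply: ordinal_trans b'a aa'; case: oa'.
(* Once [i] is in [p], left endpoints in [B i] come from [p] itself. *)
- move=> i il; have [p Gp [cp pi _]] := Ggoal i il; have [fp _ _] := cp.
  apply: sub_finite_set (finite_image left_end fp) => a [[_ [b [q [Gq qab]]]] Ba].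
  have [r [_ [_ rp] [qr _]]] := common p q Gp Gq.
  exists (opair a b); last exact: left_end_opair.
  by apply: (rp a b i) => //; apply: qr.
Qed.

End Poset.

Theorem fact1p12 (lambda : V) (lambda_card : cardinal lambda) (lambda_ge : omega1 `<=` lambda) :
  MA15 lambda -> forall tau : V, omega1 tau -> dot_principle tau lambda.
Proof.
move=> MA tau otau A HA.
pose B i := A i `&` limit.
have [|||C [clubC Clim CB]] := @club_from_MA lambda tau B lambda_card.1 lambda_ge otau _ _ _ MA.
- by move=> i /HA[Ao _] a [/Ao].
- by move=> i _ a [].
- by move=> i /HA[_]; apply: thinS => a [].
- exists C => // i /CB; apply: sub_finite_set => a [Ca Aa]; split=> //.
  by split=> //; apply: Clim.
Qed.
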